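(* Let $p>1$ be an integer, let $P(i,j)$, $i,j\ge 0$, be the super Patalan numbers of order $p$, and let $F(x,y)=\sum_{i,j\ge 0}P(i,j)x^iy^j$ be their generating function. Then $$F(x,y)=\left(\frac{x}{(1-p^2x)^{(p-1)/p}}+\frac{y}{(1-p^2y)^{1/p}}\right)\frac{1}{x+y-p^2xy}.$$
   Context: Definition. For an integer $p>1$, the super Patalan numbers of order $p$ are the rational numbers $P(i,j)$, $i,j\ge 0$, defined recursively by $P(0,0)=1$; $P(i,0)=\frac{p(pi-1)}{i}\,P(i-1,0)$ for $i\ge 1$; and $P(i,j)=\frac{p(pj-p+1)}{i+j}\,P(i,j-1)$ for $i\ge 0$, $j\ge 1$. Here $F(x,y)$ is a formal power series in $\mathbb{Q}[[x,y]]$, and for rational $\alpha$, $(1-p^2x)^{\alpha}=\sum_{k\ge 0}\binom{\alpha}{k}(-p^2x)^k$. The identity is understood in the fraction field of $\mathbb{Q}[[x,y]]$, i.e. as the identity of formal power series obtained by multiplying both sides by $x+y-p^2xy$. *)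

(* Defs.v *)
From HB Require Import structures.
From mathcomp Require Import all_boot all_order all_algebra.
From mathcomp Require Import boolp.

Set Implicit Arguments.
Unset Strict Implicit.
Unset Printing Implicit Defensive.

Import Order.TTheory GRing.Theory Num.Theory.

Local Open Scope ring_scope.

(* R[[X]], a series being given by its sequence of coefficients. *)
Record fps (R : Type) := Fps { fcoef : nat -> R }.

Lemma fpsP (R : Type) (f g : fps R) : fcoef f =1 fcoef g <-> f = g.
Proof. by split=> [|-> //]; case: f g => [u] [v] /= /funext->. Qed.

HB.instance Definition _ (R : choiceType) := gen_eqMixin (fps R).
HB.instance Definition _ (R : choiceType) := gen_choiceMixin (fps R).

Definition fps_add (R : zmodType) (f g : fps R) :=
  Fps (fun n => fcoef f n + fcoef g n).
Definition fps_opp (R : zmodType) (f : fps R) := Fps (fun n => - fcoef f n).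
Definition fps_zero (R : zmodType) : fps R := Fps (fun=> 0).

Fact fps_addA (R : zmodType) : associative (@fps_add R).
Proof. by move=> f g h; apply/fpsP=> n /=; rewrite addrA. Qed.
Fact fps_addC (R : zmodType) : commutative (@fps_add R).
Proof. by move=> f g; apply/fpsP=> n /=; rewrite addrC. Qed.
Fact fps_add0 (R : zmodType) : left_id (@fps_zero R) (@fps_add R).
Proof. by move=> f; apply/fpsP=> n /=; rewrite add0r. Qed.
Fact fps_addN (R : zmodType) : left_inverse (@fps_zero R) (@fps_opp R) (@fps_add R).
Proof. by move=> f; apply/fpsP=> n /=; rewrite addNr. Qed.

HB.instance Definition _ (R : zmodType) := GRing.isZmodule.Build (fps R)
  (@fps_addA R) (@fps_addC R) (@fps_add0 R) (@fps_addN R).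

Lemma fcoefD (R : zmodType) (f g : fps R) n :
  fcoef (f + g) n = fcoef f n + fcoef g n.
Proof. by []. Qed.

Lemma fcoefN (R : zmodType) (f : fps R) n : fcoef (- f) n = - fcoef f n.
Proof. by []. Qed.

Lemma fcoef0 (R : zmodType) n : fcoef (0 : fps R) n = 0.
Proof. by []. Qed.

Lemma fcoef_sum (R : zmodType) (I : Type) (r : seq I) (P : pred I)
    (F : I -> fps R) n :
  fcoef (\sum_(i <- r | P i) F i) n = \sum_(i <- r | P i) fcoef (F i) n.
Proof. by elim/big_rec2: _ => // i _ f _ <-. Qed.

Definition fps_one (R : comNzRingType) : fps R := Fps (fun n => (n == 0%N)%:R).
Definition fps_mul (R : comNzRingType) (f g : fps R) :=
  Fps (fun n => \sum_(k < n.+1) fcoef f k * fcoef g (n - k)).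

Fact fps_mulC (R : comNzRingType) : commutative (@fps_mul R).
Proof.
move=> f g; apply/fpsP=> n /=; rewrite (reindex_inj rev_ord_inj) /=.
by apply: eq_bigr => k _; rewrite subSS subKn ?leq_ord // mulrC.
Qed.

Fact fps_mulA (R : comNzRingType) : associative (@fps_mul R).
Proof.
have rev (f g : fps R) n :
    fcoef (fps_mul f g) n = \sum_(k < n.+1) fcoef f (n - k) * fcoef g k.
  by rewrite fps_mulC /=; apply: eq_bigr => k _; rewrite mulrC.
have fwd (f g : fps R) n :
    fcoef (fps_mul f g) n = \sum_(k < n.+1) fcoef f k * fcoef g (n - k) by [].
move=> f g h; apply/fpsP=> i; rewrite [RHS]rev [LHS]fwd.
pose c3 j k := fcoef f j * (fcoef g (i - j - k) * fcoef h k).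
transitivity (\sum_(j < i.+1) \sum_(k < i.+1 | (k <= i - j)%N) c3 j k).
  apply: eq_bigr => j _; rewrite rev big_distrr /=.
  by rewrite (big_ord_narrow_leq (leq_subr _ _)).
rewrite (exchange_big_dep predT) //; apply: eq_bigr => k _.
transitivity (\sum_(j < i.+1 | (j <= i - k)%N) c3 j k).
  apply: eq_bigl => j; rewrite -ltnS -(ltnS j) -!subSn ?leq_ord //.
  by rewrite -subn_gt0 -(subn_gt0 j) -!subnDA addnC.
rewrite (big_ord_narrow_leq (leq_subr _ _)) fwd big_distrl /=.
by apply: eq_bigr => j _; rewrite /c3 -!subnDA addnC mulrA.
Qed.

Fact fps_mul1 (R : comNzRingType) : left_id (@fps_one R) (@fps_mul R).
Proof.
move=> f; apply/fpsP=> n /=; rewrite big_ord_recl subn0 mul1r big1 ?addr0 //.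
by move=> k _; rewrite mul0r.
Qed.

Fact fps_mulDl (R : comNzRingType) : left_distributive (@fps_mul R) +%R.
Proof.
move=> f g h; apply/fpsP=> n /=; rewrite -big_split /=.
by apply: eq_bigr => k _; rewrite mulrDl.
Qed.

Fact fps_one_neq0 (R : comNzRingType) : fps_one R != 0.
Proof. by apply/eqP => /fpsP /(_ 0) /= /eqP; rewrite oner_eq0. Qed.

HB.instance Definition _ (R : comNzRingType) :=
  GRing.Zmodule_isComNzRing.Build (fps R) (@fps_mulA R) (@fps_mulC R)
    (@fps_mul1 R) (@fps_mulDl R) (@fps_one_neq0 R).

Lemma fcoefM (R : comNzRingType) (f g : fps R) n :
  fcoef (f * g) n = \sum_(k < n.+1) fcoef f k * fcoef g (n - k).
Proof. by []. Qed.

Lemma fcoef1 (R : comNzRingType) n : fcoef (1 : fps R) n = (n == 0%N)%:R.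
Proof. by []. Qed.

Definition fps_unit (R : comNzRingType) : {pred fps R} :=
  fun f => `[< exists g, g * f = 1 >].
Definition fps_inv (R : comNzRingType) (f : fps R) : fps R :=
  if pselect (exists g, g * f = 1) is left fU then sval (cid fU) else f.

Fact fps_mulV (R : comNzRingType) :
  {in @fps_unit R, left_inverse 1 (@fps_inv R) *%R}.
Proof.
by move=> f /asboolP fU; rewrite /fps_inv; case: pselect => // ?; case: cid.
Qed.

Fact fps_unitP (R : comNzRingType) (f g : fps R) : g * f = 1 -> fps_unit f.
Proof. by move=> gf1; apply/asboolP; exists g. Qed.

Fact fps_inv_out (R : comNzRingType) : {in [predC @fps_unit R], @fps_inv R =1 id}.
Proof. by move=> f /asboolP fN; rewrite /fps_inv; case: pselect. Qed.

HB.instance Definition _ (R : comNzRingType) :=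
  GRing.ComNzRing_hasMulInverse.Build (fps R)
    (@fps_mulV R) (@fps_unitP R) (@fps_inv_out R).

Fact fps_integral (R : idomainType) (f g : fps R) :
  f * g = 0 -> (f == 0) || (g == 0).
Proof.
have low (h : fps R) : h != 0 ->
    exists2 m, fcoef h m != 0 & forall k, (k < m)%N -> fcoef h k = 0.
  move=> h0; have exm : exists m, fcoef h m != 0.
    apply/not_existsP => hN; case/eqP: h0; apply/fpsP => n.
    by apply/eqP; apply/negPn/negP/hN.
  case: (ex_minnP exm) => m hm mmin; exists m => // k km.
  by apply/eqP/negPn/negP => /mmin; rewrite leqNgt km.
move=> fg0; apply/negPn/negP; rewrite negb_or => /andP[/low[m fm fm0]].
move=> /low[n gn gn0]; have /fpsP/(_ (m + n)%N) := fg0; rewrite fcoefM /=.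
have mP : (m < (m + n).+1)%N by rewrite ltnS leq_addr.
rewrite (bigD1 (Ordinal mP)) //= big1 => [|k kNm].
  by rewrite addr0 addKn; apply/eqP; rewrite mulf_neq0.
case: (ltngtP k m) => [km|mk|km]; first by rewrite fm0 ?mul0r.
  by rewrite gn0 ?mulr0 // ltn_subLR ?ltn_add2r // -ltnS.
by case/eqP: kNm; apply: val_inj.
Qed.

HB.instance Definition _ (R : idomainType) :=
  GRing.ComUnitRing_isIntegral.Build (fps R) (@fps_integral R).

Definition fps_X : fps rat := Fps (fun n => (n == 1%N)%:R).

(* Q[[x,y]] as Q[[y]][[x]]: the outer variable is x, the inner one is y. *)
Notation fps2 := (fps (fps rat)).

(* The series \sum_(i, j) c i j x^i y^j. *)
Definition series2 (c : nat -> nat -> rat) : fps2 :=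
  Fps (fun i => Fps (fun j => c i j)).

Lemma coef_fps2M (f g : fps2) i j :
  fcoef (fcoef (f * g) i) j =
  \sum_(k < i.+1) \sum_(l < j.+1)
    fcoef (fcoef f k) l * fcoef (fcoef g (i - k)) (j - l).
Proof. by rewrite fcoefM fcoef_sum. Qed.

(* f(x) and f(y) in Q[[x,y]], for a series f in one variable. *)
Definition in_x (f : fps rat) : fps2 :=
  series2 (fun i j => if j == 0%N then fcoef f i else 0).
Definition in_y (f : fps rat) : fps2 :=
  series2 (fun i j => if i == 0%N then fcoef f j else 0).

Definition gbinom (a : rat) (k : nat) : rat :=
  (\prod_(l < k) (a - l%:R)) / k`!%:R.

(* (1 - c X)^a = \sum_k gbinom a k * (- c X)^k. *)
Definition one_sub_pow (c a : rat) : fps rat :=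
  Fps (fun k => gbinom a k * (- c) ^+ k).

Fixpoint super_patalan_col0 (p i : nat) : rat :=
  if i is i'.+1 then
    p%:R * (p%:R * i%:R - 1) / i%:R * super_patalan_col0 p i'
  else 1.

Fixpoint super_patalan (p i j : nat) : rat :=
  if j is j'.+1 then
    p%:R * (p%:R * j%:R - p%:R + 1) / (i + j)%:R * super_patalan p i j'
  else super_patalan_col0 p i.

Definition super_patalan_gf (p : nat) : fps2 := series2 (super_patalan p).

(* Main.v *)
Require Import Defs.
From mathcomp Require Import all_boot all_order all_algebra.
From mathcomp Require Import ring.

Import GRing.Theory.
Local Open Scope ring_scope.

(** Multiplying by [x + y - p^2 x y] and comparing coefficients, the identity
    amounts to [P(i-1,j) + P(i,j-1) = p^2 P(i-1,j-1)] for [i, j >= 1], plus the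
    fact that the boundary rows [P(i,0)] and [P(0,j)] are the coefficients of
    [(1 - p^2 x)^(-(p-1)/p)] and [(1 - p^2 y)^(-1/p)]. The former holds because
    [P] also satisfies a recursion in its first index, so that [P(i-1,j)] and
    [P(i,j-1)] are both explicit multiples of [P(i-1,j-1)]. *)

Lemma natr_rat_neq0 (n : nat) : n.+1%:R != 0 :> rat.
Proof. by rewrite Num.Theory.pnatr_eq0. Qed.

(** Coefficient form of the differential equation [(1 - c X) f' = - a c f]. *)
Lemma one_sub_powS (c a : rat) (n : nat) :
  n.+1%:R * fcoef (one_sub_pow c a) n.+1 =
  c * (n%:R - a) * fcoef (one_sub_pow c a) n.
Proof.
rewrite /= /gbinom big_ord_recr factS natrM invfM exprS /=.
have nz := natr_rat_neq0 n.
set P := \prod_(i < n) _; rewrite -{1}[n.+1%:R]mulr1.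
set q := n`!%:R^-1; set e := (- c) ^+ n.
transitivity ((n.+1%:R / n.+1%:R) * (P * (a - n%:R) * q * (- c * e))).
  by ring.
by rewrite divff //; ring.
Qed.

(** The equation determines its solution up to the constant term. The exponent law and both boundary
    rows are identified this way. *)
Lemma one_sub_pow_uniq (c a : rat) (u : nat -> rat) :
  u 0%N = 1 -> (forall n, n.+1%:R * u n.+1 = c * (n%:R - a) * u n) ->
  u =1 fcoef (one_sub_pow c a).
Proof.
move=> u0 uS; elim=> [|n IHn].
  by rewrite u0 /= /gbinom big_ord0 fact0 divr1 mulr1.
by apply: (mulfI (natr_rat_neq0 n)); rewrite uS one_sub_powS IHn.
Qed.

(** Leibniz rule: the product satisfies the differential equation with exponent [a + b]. *)
Lemma one_sub_powD (c a b : rat) :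
  one_sub_pow c a * one_sub_pow c b = one_sub_pow c (a + b).
Proof.
set f := one_sub_pow c a; set g := one_sub_pow c b.
have fS := one_sub_powS c a; have gS := one_sub_powS c b.
apply/fpsP; apply: one_sub_pow_uniq => [|n].
  rewrite fcoefM big_ord1 /= /gbinom !big_ord0 fact0.
  by rewrite !divr1.
rewrite -/f in fS; rewrite -/g in gS; clearbody f g.
(* Split the factor [n + 1] as [k + (n + 1 - k)] in the convolution. *)
have split_n : n.+1%:R * fcoef (f * g) n.+1 =
    \sum_(k < n.+2) k%:R * fcoef f k * fcoef g (n.+1 - k)
    + \sum_(k < n.+2) fcoef f k * ((n.+1 - k)%:R * fcoef g (n.+1 - k)).
  rewrite fcoefM big_distrr -big_split /=; apply: eq_bigr => k _.
  by rewrite natrB ?leq_ord //; ring.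
(* The first sum loses its term [k = 0] and the second its term [k = n + 1]. After reindexing, both
   run over [k <= n], and termwise [c (k - a) + c (n - k - b) = c (n - (a + b))]. *)
rewrite split_n fcoefM big_distrr big_ord_recl !mul0r add0r.
rewrite [X in _ + X]big_ord_recr /=.
rewrite subnn mul0r mulr0 addr0 -big_split /=.
apply: eq_bigr => k _; rewrite /bump /= add1n subSS fS.
by rewrite subSn ?leq_ord // gS natrB ?leq_ord //; ring.
Qed.

Lemma one_sub_pow0 (c : rat) : one_sub_pow c 0 = 1.
Proof.
apply/fpsP=> n; apply/esym; apply: one_sub_pow_uniq n => [//|n].
by rewrite !fcoef1; case: n => [|n]; rewrite ?subr0 !(mulr0, mul0r).
Qed.

Lemma in_x_mul : {morph in_x : f g / f * g}.
Proof.
move=> f g; apply/fpsP=> i; apply/fpsP=> j; rewrite coef_fps2M /=.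
case: j => [|j] /=.
  by apply: eq_bigr => k _; rewrite big_ord1.
rewrite big1 // => k _; rewrite big1 // => [] [[|l] ltl] _ /=.
  by rewrite mulr0.
by rewrite mul0r.
Qed.

Lemma in_y_mul : {morph in_y : f g / f * g}.
Proof.
move=> f g; apply/fpsP=> i; apply/fpsP=> j; rewrite coef_fps2M /=.
case: i => [|i] /=.
  by rewrite big_ord1.
rewrite big1 // => [] [[|k] ltk] _ /=; rewrite big1 // => l _.
  by rewrite mulr0.
by rewrite mul0r.
Qed.

Lemma in_x1 : in_x 1 = 1.
Proof. by apply/fpsP=> - [|i]; apply/fpsP=> - [|j]. Qed.

Lemma in_y1 : in_y 1 = 1.
Proof. by apply/fpsP=> - [|i]; apply/fpsP=> - [|j]. Qed.

Lemma coef_in_xXM (G : fps2) (i j : nat) :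
  fcoef (fcoef (in_x fps_X * G) i) j =
  if i is i'.+1 then fcoef (fcoef G i') j else 0.
Proof.
have coefX k l : fcoef (fcoef (in_x fps_X) k) l = ((k == 1) && (l == 0))%N%:R.
  by case: l => [|l]; rewrite /= ?andbT // andbF.
rewrite coef_fps2M; under eq_bigr => k _ do under eq_bigr => l _ do rewrite coefX.
case: i => [|i].
  by rewrite big_ord1 big1 // => l _; rewrite mul0r.
rewrite big_ord_recl big1 => [|l _]; last by rewrite mul0r.
rewrite add0r big_ord_recl /= [X in _ + X]big1 => [|k _]; last first.
  by rewrite big1 // => l _; rewrite mul0r.
rewrite addr0 big_ord_recl /= big1 => [|l _]; last by rewrite mul0r.
by rewrite mul1r addr0 subn0 subSS subn0.
Qed.

Lemma coef_in_yXM (G : fps2) (i j : nat) :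
  fcoef (fcoef (in_y fps_X * G) i) j =
  if j is j'.+1 then fcoef (fcoef G i) j' else 0.
Proof.
have coefX k l : fcoef (fcoef (in_y fps_X) k) l = ((k == 0) && (l == 1))%N%:R.
  by case: k => [|k].
rewrite coef_fps2M; under eq_bigr => k _ do under eq_bigr => l _ do rewrite coefX.
rewrite big_ord_recl /= [X in _ + X]big1 => [|k _]; last first.
  by rewrite big1 // => l _; rewrite mul0r.
rewrite addr0 big_ord_recl mul0r add0r; case: j => [|j]; first by rewrite big_ord0.
rewrite big_ord_recl /= big1 => [|l _]; last by rewrite mul0r.
by rewrite mul1r addr0 subn0 subSS subn0.
Qed.

Lemma coef_fps2Mn (f : fps2) (n i j : nat) :
  fcoef (fcoef (f *+ n) i) j = fcoef (fcoef f i) j *+ n.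
Proof. by elim: n => [|n IHn] //; rewrite !mulrS !fcoefD IHn. Qed.

(** For [c = p^2] and [a = - (p - 1) / p], the factor [c (n - a)] is [p (p (n + 1) - 1)]. *)
Lemma super_patalan_col0E (p : nat) : (1 < p)%N ->
  super_patalan_col0 p
    =1 fcoef (one_sub_pow (p%:R ^+ 2) (- ((p%:R - 1) / p%:R))).
Proof.
case: p => [//|p] _; apply: one_sub_pow_uniq => // n.
have pnz := natr_rat_neq0 p; have nnz := natr_rat_neq0 n.
have -> : n.+1%:R * super_patalan_col0 p.+1 n.+1 =
    p.+1%:R * (p.+1%:R * n.+1%:R - 1) * super_patalan_col0 p.+1 n.
  by rewrite [super_patalan_col0 _ n.+1]/= mulrA [n.+1%:R * _]mulrC divfK.
by rewrite -[n.+1]addn1 natrD; field; rewrite nat1r.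
Qed.

Lemma super_patalanSr (p i j : nat) :
  (i + j.+1)%:R * super_patalan p i j.+1 =
  p%:R * (p%:R * j%:R + 1) * super_patalan p i j.
Proof.
have nz := natr_rat_neq0 (i + j); rewrite /= mulrA addnS mulrC.
by rewrite [_%:R * _]mulrC divfK // -[j.+1]addn1 natrD mulrC;
  congr (_ * _); ring.
Qed.

(** For [c = p^2] and [a = - 1 / p], the factor [c (n - a)] is [p (p n + 1)]. *)
Lemma super_patalan_row0E (p : nat) : (1 < p)%N ->
  super_patalan p 0 =1 fcoef (one_sub_pow (p%:R ^+ 2) (- (1 / p%:R))).
Proof.
case: p => [//|p] _; apply: one_sub_pow_uniq => // n.
have pnz := natr_rat_neq0 p.
by rewrite -[n.+1 in LHS]add0n super_patalanSr; field; rewrite nat1r.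
Qed.

(** The definition gives this for [j = 0] only. It propagates along [j] because the step factors
    commute: each numerator involves only the index that moves, each denominator only [i + j]. *)
Lemma super_patalanSl (p i j : nat) :
  (i.+1 + j)%:R * super_patalan p i.+1 j =
  p%:R * (p%:R * i.+1%:R - 1) * super_patalan p i j.
Proof.
have nz := natr_rat_neq0; elim: j => [|j IHj].
  by rewrite addn0 [LHS]/= mulrA [i.+1%:R * _]mulrC divfK.
apply: (mulfI (nz (i + j)%N)); rewrite super_patalanSr mulrCA -addSn IHj.
rewrite [in RHS]mulrCA addSnnS super_patalanSr; ring.
Qed.

(** Both terms on the left have denominator [i + j + 1] over [P(i,j)], and the numerators add up: [p
    (p j + 1) + p (p (i + 1) - 1) = p^2 (i + j + 1)]. *)
Lemma super_patalan_rec (p i j : nat) :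
  super_patalan p i j.+1 + super_patalan p i.+1 j =
  (p ^ 2)%:R * super_patalan p i j.
Proof.
have nz := natr_rat_neq0 (i + j).
apply: (mulfI nz); rewrite mulrDr -{1}addnS super_patalanSr -addSn super_patalanSl.
by rewrite natrX addSn -[(i + j).+1]addn1 -[i.+1]addn1 !natrD; ring.
Qed.

(** Negated exponents stand in for the inverses, so the identity lives in [fps2] and can be checked
    on coefficients. *)
Lemma super_patalan_gf_mul (p : nat) : (1 < p)%N ->
  let x := in_x fps_X in let y := in_y fps_X in
  super_patalan_gf p * (x + y - (p ^ 2)%:R * x * y) =
  x * in_x (one_sub_pow (p%:R ^+ 2) (- ((p%:R - 1) / p%:R)))
  + y * in_y (one_sub_pow (p%:R ^+ 2) (- (1 / p%:R))).
Proof.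
move=> hp x y; set F := super_patalan_gf p.
have -> : F * (x + y - (p ^ 2)%:R * x * y) =
    x * F + y * F - (x * (y * F)) *+ (p ^ 2).
  by rewrite -mulr_natl; ring.
apply/fpsP=> i; apply/fpsP=> j.
rewrite !(fcoefD, fcoefN) coef_fps2Mn !(coef_in_xXM, coef_in_yXM).
(* On the axis [i = 0] only [y * F] contributes, which gives the row [P(0,j)]; on [j = 0] only
   [x * F], which gives [P(i,0)]. Off the axes the right side vanishes. *)
case: i j => [|i] [|j]; rewrite ?mul0rn ?subr0 ?add0r ?addr0 //.
- exact: super_patalan_row0E.
- by rewrite coef_in_yXM mul0rn subr0; apply: super_patalan_col0E.
- by rewrite coef_in_yXM /= super_patalan_rec mulr_natl subrr.
Qed.

Theorem theorem2p3 (p : nat) (hp : (1 < p)%N) :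
  let x : {fraction fps2} := tofrac (in_x fps_X) in
  let y : {fraction fps2} := tofrac (in_y fps_X) in
  let c : rat := p%:R ^+ 2 in
  let Ax : {fraction fps2} :=
    tofrac (in_x (one_sub_pow c ((p%:R - 1) / p%:R))) in
  let Ay : {fraction fps2} := tofrac (in_y (one_sub_pow c (1 / p%:R))) in
  tofrac (super_patalan_gf p) =
    (x / Ax + y / Ay) * (1 / (x + y - p%:R ^+ 2 * x * y)).
Proof.
move=> x y c Ax Ay.
have pow1 a : one_sub_pow c a * one_sub_pow c (- a) = 1.
  by rewrite one_sub_powD subrr one_sub_pow0.
(* Inverses of [Ax] and [Ay] in the fraction field come from inverses in [fps2], namely the opposite
   powers. *)
have invE (A B : fps2) : A * B = 1 -> (tofrac A)^-1 = tofrac B.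
  move=> AB1; have AB1' : tofrac A * tofrac B = 1.
    by rewrite -tofracM AB1 tofrac1.
  have A0 : tofrac A != 0.
    by apply/eqP => A0; move/eqP: AB1'; rewrite A0 mul0r eq_sym oner_eq0.
  by apply: (mulfI A0); rewrite AB1' divff.
have AxV : Ax^-1 = tofrac (in_x (one_sub_pow c (- ((p%:R - 1) / p%:R)))).
  by apply: invE; rewrite -in_x_mul pow1 in_x1.
have AyV : Ay^-1 = tofrac (in_y (one_sub_pow c (- (1 / p%:R)))).
  by apply: invE; rewrite -in_y_mul pow1 in_y1.
pose d : fps2 := in_x fps_X + in_y fps_X - (p ^ 2)%:R * in_x fps_X * in_y fps_X.
have -> : x + y - p%:R ^+ 2 * x * y = tofrac d.
  by rewrite /d tofracB tofracD !tofracM -natrX rmorph_nat.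
(* The coefficient of [x] in [d] is 1. *)
have d0 : tofrac d != 0.
  rewrite tofrac_eq0; apply/eqP => /(congr1 (fun f => fcoef (fcoef f 1) 0)).
  rewrite /d -mulrA mulr_natl !(fcoefD, fcoefN) coef_fps2Mn coef_in_xXM /=.
  by move/eqP; rewrite mul0rn subr0 addr0 oner_eq0.
rewrite AxV AyV -!tofracM -tofracD -super_patalan_gf_mul //.
by rewrite tofracM div1r mulfK.
Qed.
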